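(* Let $m\ge 2$ be an integer and $n=2^m$. Then the line graph $L(\overline{\Gamma(\mathbb{Z}_n[i])})$ of the complement of the zero-divisor graph of $\mathbb{Z}_n[i]$ is pancyclic.
   Context: $\mathbb{Z}_n[i]=\mathbb{Z}[i]/\langle n\rangle=\{a+bi : a,b\in\mathbb{Z}_n\}$ with $i^2=-1$. For a finite commutative ring $R$ with unity, $\Gamma(R)$ has vertex set the nonzero zero-divisors of $R$, distinct $x,y$ adjacent iff $xy=0$. $\overline{G}$ is the complement graph of $G$. The line graph $L(G)$ has the edges of $G$ as vertices, two being adjacent iff they share an endpoint in $G$. A graph of order $N$ is pancyclic if $N\ge 3$ and it contains a cycle of length $k$ for every $3\le k\le N$. *)

(* Defs.v *)
From HB Require Import structures.
From mathcomp Require Import all_boot all_order all_fingroup all_algebra.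
From mathcomp Require Import ring.

Set Implicit Arguments.
Unset Strict Implicit.
Unset Printing Implicit Defensive.

Import GRing.Theory.
Local Open Scope ring_scope.

(** R[i] = {a + b i : a, b in R} with i^2 = -1; Z_n[i] is [gaussian 'Z_n]
    (for n > 1, since 'Z_0 and 'Z_1 both denote Z/2Z). *)
Record gaussian (R : Type) : Type := Gaussian { gre : R; gim : R }.

Section GaussianFinite.
Variable R : Type.

Definition pair_of_gaussian (z : gaussian R) : R * R := (gre z, gim z).
Definition gaussian_of_pair (p : R * R) : gaussian R := Gaussian p.1 p.2.

Lemma pair_of_gaussianK : cancel pair_of_gaussian gaussian_of_pair.
Proof. by case. Qed.

End GaussianFinite.

HB.instance Definition _ (R : eqType) :=
  Equality.copy (gaussian R) (can_type (@pair_of_gaussianK R)).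
HB.instance Definition _ (R : choiceType) :=
  Choice.copy (gaussian R) (can_type (@pair_of_gaussianK R)).
HB.instance Definition _ (R : countType) :=
  Countable.copy (gaussian R) (can_type (@pair_of_gaussianK R)).
HB.instance Definition _ (R : finType) :=
  Finite.copy (gaussian R) (can_type (@pair_of_gaussianK R)).

Section GaussianRing.
Variable R : comNzRingType.
Implicit Types x y z : gaussian R.

Definition gzero : gaussian R := Gaussian 0 0.
Definition gone : gaussian R := Gaussian 1 0.
Definition gadd x y : gaussian R := Gaussian (gre x + gre y) (gim x + gim y).
Definition gopp x : gaussian R := Gaussian (- gre x) (- gim x).
Definition gmul x y : gaussian R :=
  Gaussian (gre x * gre y - gim x * gim y) (gre x * gim y + gim x * gre y).

Lemma gaddA : associative gadd.
Proof. by move=> x y z; rewrite /gadd /= !addrA. Qed.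
Lemma gaddC : commutative gadd.
Proof. by move=> x y; congr Gaussian; apply: addrC. Qed.
Lemma gadd0 : left_id gzero gadd.
Proof. by case=> a b; rewrite /gadd /= !add0r. Qed.
Lemma gaddN : left_inverse gzero gopp gadd.
Proof. by move=> x; rewrite /gadd /= !addNr. Qed.

HB.instance Definition _ :=
  GRing.isZmodule.Build (gaussian R) gaddA gaddC gadd0 gaddN.

Lemma gmulA : associative gmul.
Proof. by move=> x y z; congr Gaussian => /=; ring. Qed.
Lemma gmulC : commutative gmul.
Proof. by move=> x y; congr Gaussian => /=; ring. Qed.
Lemma gmul1 : left_id gone gmul.
Proof. by case=> a b; congr Gaussian => /=; ring. Qed.
Lemma gmulDl : left_distributive gmul gadd.
Proof. by move=> x y z; congr Gaussian => /=; ring. Qed.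
Lemma gone_neq0 : gone != 0.
Proof. by apply/eqP => -[] /eqP; rewrite oner_eq0. Qed.

HB.instance Definition _ :=
  GRing.Zmodule_isComNzRing.Build (gaussian R)
    gmulA gmulC gmul1 gmulDl gone_neq0.

Lemma gaussian_i2 : Gaussian 0 1 * Gaussian 0 1 = -1 :> gaussian R.
Proof. by congr Gaussian => /=; ring. Qed.

End GaussianRing.

(** Lets the canonical [finComNzRingType] structure be inferred. *)
HB.instance Definition _ (R : finComNzRingType) := Finite.on (gaussian R).

Record sgraph := SGraph {
  vertex :> finType;
  adj : rel vertex;
  adj_sym : symmetric adj;
  adj_irr : irreflexive adj
}.

Section ZeroDivisorGraph.
Variable R : finComNzRingType.

Definition zero_divisor (x : R) : bool := [exists y, (y != 0) && (x * y == 0)].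

Definition zdg_vertex : finType := {x : R | (x != 0) && zero_divisor x}.

Definition zdg_adj : rel zdg_vertex :=
  fun x y => (x != y) && (val x * val y == 0).

Lemma zdg_adj_sym : symmetric zdg_adj.
Proof. by move=> x y; rewrite /zdg_adj eq_sym mulrC. Qed.
Lemma zdg_adj_irr : irreflexive zdg_adj.
Proof. by move=> x; rewrite /zdg_adj eqxx. Qed.

Definition zero_divisor_graph : sgraph := SGraph zdg_adj_sym zdg_adj_irr.

End ZeroDivisorGraph.

Section GraphOperations.
Variable G : sgraph.

Definition compl_adj : rel G := fun x y => (x != y) && ~~ adj x y.

Lemma compl_adj_sym : symmetric compl_adj.
Proof. by move=> x y; rewrite /compl_adj eq_sym adj_sym. Qed.
Lemma compl_adj_irr : irreflexive compl_adj.
Proof. by move=> x; rewrite /compl_adj eqxx. Qed.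

Definition complement_graph : sgraph := SGraph compl_adj_sym compl_adj_irr.

Definition is_edge (e : {set G}) : bool :=
  [exists x, exists y, adj x y && (e == [set x; y])].

Definition edge : finType := {e : {set G} | is_edge e}.

Definition line_adj : rel edge :=
  fun e f => (e != f) && (val e :&: val f != set0).

Lemma line_adj_sym : symmetric line_adj.
Proof. by move=> e f; rewrite /line_adj eq_sym setIC. Qed.
Lemma line_adj_irr : irreflexive line_adj.
Proof. by move=> e; rewrite /line_adj eqxx. Qed.

Definition line_graph : sgraph := SGraph line_adj_sym line_adj_irr.

(** [ucycle (@adj G) c] alone also accepts sequences of fewer than three
    vertices (a single edge traversed both ways, or the empty sequence);
    it is a genuine cycle of length [k] of a simple graph when [k >= 3]. *)
Definition has_cycle_of_length (k : nat) : Prop :=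
  exists c : seq G, [/\ (3 <= k)%N, size c = k & ucycle (@adj G) c].

Definition pancyclic : Prop :=
  (3 <= #|G|)%N /\
  forall k : nat, (3 <= k <= #|G|)%N -> has_cycle_of_length k.

End GraphOperations.

(* Main.v *)
(** In [Z_(2^m)[i]] the element [p := 1 + i] is nilpotent and every element is
    congruent to 0 or 1 modulo [p]; these two facts and the size of the ring are
    all that is used.  The zero divisors are then the multiples of [p].  Those of
    the form [p + p^2 z] are [p] times a regular element, so they annihilate only
    the isolated vertices of the complement of the zero-divisor graph and are
    adjacent there to all other vertices; moreover they make up at least half of
    the non-isolated part.  Alternating between the two kinds of vertices gives a
    cycle [C] through the whole non-isolated part.  In the line graph, the edges
    at one vertex [p + p^2 z] form a clique of size [|C| - 1], which contains the
    cycles of length less than [|C|].  Following [C] while inserting any set of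
    chords, each at one of its endpoints, gives all longer cycles. *)
Require Import Defs.
From mathcomp Require Import all_boot all_algebra.
From mathcomp Require Import ring.

Set Implicit Arguments.
Unset Strict Implicit.
Unset Printing Implicit Defensive.

Import GRing.Theory.

Section Sequences.
Variable T : eqType.
Implicit Types (r : rel T) (s t : seq T).

Lemma path_uniq_neq r x s :
  uniq (x :: s) -> path r x s -> path [rel y z | (y != z) && r y z] x s.
Proof.
elim: s x => //= y s IHs x /andP[] /[!inE] /norP[-> _] us /andP[-> ps].
exact: IHs.
Qed.

Lemma cycle_uniq_neq r s :
  1 < size s -> uniq s -> cycle r s -> cycle [rel y z | (y != z) && r y z] s.
Proof.
case: s => [|x [|y s]] // _ us; rewrite /cycle !rcons_path.
move=> /andP[/(path_uniq_neq us) -> /= ->]; rewrite andbT.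
by case/andP: us => + _; apply: contraNneq => <-; rewrite mem_last.
Qed.

Lemma perm_flatten_fibers (U : eqType) (h : T -> U) s (c : seq U) :
  uniq c ->
  perm_eq (flatten [seq [seq e <- s | h e == v] | v <- c])
          [seq e <- s | h e \in c].
Proof.
elim: c => [_|v c IHc /= /andP[vNc uc]]; first by rewrite filter_pred0.
have /(perm_cat (perm_refl [seq e <- s | h e == v])) := IHc uc.
move=> /perm_trans->//; rewrite perm_sym.
rewrite -(perm_filterC [pred e | h e == v]) -!filter_predI; apply: perm_cat;
  apply/permP => a; congr count; apply: eq_filter => e /=; rewrite inE.
- by case: eqP.
- by case: eqP => // ->; rewrite (negPf vNc).
Qed.

Lemma perm_flatten_pairmap_rcons (U : Type) (B : U -> seq T) (f : U -> U -> T)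
    x p y :
  perm_eq (flatten (pairmap (fun v w => rcons (B v) (f v w)) x (rcons p y)))
          (flatten (map B (x :: p)) ++ pairmap f x (rcons p y)).
Proof.
elim: p x => [|z p IHp] x /=; first by rewrite !cats0 cats1.
rewrite cat_rcons -catA perm_cat2l perm_sym -[f x z :: pairmap _ _ _]cat1s.
by rewrite perm_catCA /= perm_cons perm_sym; apply: IHp.
Qed.

Fixpoint interleave s t : seq T :=
  if s is b :: s' then
    if t is a :: t' then b :: a :: interleave s' t' else s
  else t.

Lemma perm_interleave s t : perm_eq (interleave s t) (s ++ t).
Proof.
elim: s t => [|b s IHs] [|a t] //=; first by rewrite cats0.
rewrite perm_cons (perm_trans (_ : perm_eq _ (a :: (s ++ t)))) ?perm_cons //.
by rewrite -cat1s perm_catCA.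
Qed.

Lemma path_interleave (A : pred T) a s t :
  A a -> all A t -> size s <= (size t).+1 ->
  path [rel x y | A x || A y] a (interleave s t).
Proof.
elim: s a t => [|b s IHs] a [|a' t] //= Aa.
- move=> /andP[Aa' At] _; rewrite Aa /=.
  by elim: t a' Aa' At => //= z t IHt a' -> /andP[Az /(IHt _ Az)].
- by case: s {IHs} => // _ _; rewrite Aa.
- by move=> /andP[Aa' At] les; rewrite Aa Aa' orbT IHs.
Qed.

End Sequences.

Section LineGraph.
Variable G : sgraph.
Implicit Types (x y v : G) (e f : edge G).

Lemma is_edge_adj x y : adj x y -> is_edge [set x; y].
Proof.
by move=> xy; apply/existsP; exists x; apply/existsP; exists y; rewrite xy /=.
Qed.

Definition meets : rel (edge G) := fun e f => val e :&: val f != set0.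

Lemma meets_at x e f : x \in val e -> x \in val f -> meets e f.
Proof. by move=> xe xf; apply/set0Pn; exists x; rewrite inE xe. Qed.

Lemma path_meets_star x e s :
  x \in val e -> {in s, forall f, x \in val f} -> path meets e s.
Proof.
elim: s e => //= f s IHs e xe xs.
have xf : x \in val f by apply: xs; rewrite mem_head.
by rewrite (meets_at xe xf) IHs // => g gs; apply: xs; rewrite inE gs orbT.
Qed.

Lemma has_cycle_line_graph (c : seq (edge G)) :
  2 < size c -> uniq c -> cycle meets c ->
  has_cycle_of_length (line_graph G) (size c).
Proof.
move=> c3 uc mc; exists c; split=> //; apply/andP; split; last exact: uc.
exact: cycle_uniq_neq (ltnW c3) uc mc.
Qed.

Section EdgeOf.
Variable e0 : edge G.

(* Junk value [e0] when [x] and [y] are not adjacent. *)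
Definition edge_of x y : edge G := insubd e0 [set x; y].

Lemma val_edge_of x y : adj x y -> val (edge_of x y) = [set x; y].
Proof. by move=> xy; rewrite val_insubd is_edge_adj. Qed.

Lemma mem_edge_of x y v :
  adj x y -> (v \in val (edge_of x y)) = (v == x) || (v == y).
Proof. by move=> xy; rewrite val_edge_of // !inE. Qed.

Lemma edge_ofC x y : edge_of x y = edge_of y x.
Proof. by rewrite /edge_of setUC. Qed.

Lemma edge_of_inj x : {in adj x &, injective (edge_of x)}.
Proof.
move=> y z xy xz /(congr1 val)/setP/(_ y).
rewrite !mem_edge_of // eqxx orbT => /esym/orP[] /eqP // yx.
by move: xy; rewrite yx [_ \in _]adj_irr.
Qed.

Lemma pairmap_edge_of_sub x p e :
  path (@adj G) x p -> e \in pairmap edge_of x p -> {subset val e <= x :: p}.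
Proof.
elim: p x => //= y p IHp x /andP[xy yp]; rewrite inE => /orP[/eqP->|ep] v.
  by rewrite mem_edge_of // !inE => /orP[] ->; rewrite ?orbT.
by move=> /(IHp _ yp ep) vyp; rewrite inE vyp orbT.
Qed.

Lemma uniq_pairmap_edge_of x p :
  uniq (x :: p) -> path (@adj G) x p -> uniq (pairmap edge_of x p).
Proof.
elim: p x => //= y p IHp x /andP[xNp up] /andP[xy yp].
rewrite IHp // andbT; apply: contra xNp => /(pairmap_edge_of_sub yp); apply.
by rewrite mem_edge_of // eqxx.
Qed.

Definition cycle_edges x p := pairmap edge_of x (rcons p x).

Lemma uniq_cycle_edges x p :
  uniq (x :: p) -> 1 < size p -> cycle (@adj G) (x :: p) ->
  uniq (cycle_edges x p).
Proof.
case: p => // y p uxyp; rewrite /= rcons_path ltnS => p_gt0 /and3P[xy yp lx].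
have /andP[xNyp /[dup] uyp /andP[yNp _]] := uxyp.
have xl : adj x (last y p) by rewrite adj_sym.
rewrite -cats1 pairmap_cat /= cats1 mem_rcons inE negb_or rcons_uniq.
have notin_path z : adj x z -> edge_of x z \notin pairmap edge_of y p.
  move=> xz; apply: contra xNyp => /(pairmap_edge_of_sub yp); apply.
  by rewrite mem_edge_of ?eqxx.
rewrite [edge_of _ x]edge_ofC !notin_path ?uniq_pairmap_edge_of // !andbT.
apply: contra yNp => /eqP/(edge_of_inj xy xl) ->.
case: p p_gt0 {uxyp xNyp uyp yp lx xl notin_path} => //= z p _.
exact: mem_last.
Qed.

(* The closed walk [x :: p] unrolled in the line graph, with the chords [D]
   inserted when passing the endpoint [h] selects. *)
Definition chord_tour (h : edge G -> G) (D : seq (edge G)) x p :=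
  flatten (pairmap (fun v w => rcons [seq f <- D | h f == v] (edge_of v w))
                   x (rcons p x)).

Lemma perm_chord_tour h D x p :
  uniq (x :: p) -> (forall e, h e \in x :: p) ->
  perm_eq (chord_tour h D x p) (D ++ cycle_edges x p).
Proof.
move=> uxp hp; apply: perm_trans (perm_flatten_pairmap_rcons _ _ _ _ _) _.
rewrite perm_cat2r; apply: perm_trans (perm_flatten_fibers _ _ uxp) _.
by rewrite (@eq_filter _ _ predT) ?filter_predT // => e; rewrite /= hp.
Qed.

Lemma path_meets_walk (B : G -> seq (edge G)) e x p :
  (forall v, {in B v, forall f, v \in val f}) ->
  x \in val e -> path (@adj G) x p ->
  path meets e (flatten (pairmap (fun v w => rcons (B v) (edge_of v w)) x p)).
Proof.
move=> BP; elim: p x e => [|y p IHp] x e xe //= /andP[xy yp].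
rewrite cat_path last_rcons (IHp y) ?mem_edge_of ?eqxx ?orbT // andbT.
apply: path_meets_star xe _ => f; rewrite mem_rcons inE => /orP[/eqP->|/BP//].
by rewrite mem_edge_of ?eqxx.
Qed.

Lemma cycle_chord_tour h D x p :
  (forall e, h e \in val e) -> cycle (@adj G) (x :: p) ->
  cycle meets (chord_tour h D x p).
Proof.
move=> hP cxp; have lx : adj (last x p) x.
  by move: cxp; rewrite /= rcons_path => /andP[].
have : path meets (edge_of (last x p) x) (chord_tour h D x p).
  apply: path_meets_walk cxp; last by rewrite mem_edge_of ?eqxx ?orbT.
  by move=> v f; rewrite mem_filter => /andP[/eqP<-].
have : last (edge_of (last x p) x) (chord_tour h D x p) = edge_of (last x p) x.
  rewrite /chord_tour -cats1 pairmap_cat flatten_cat /= cats0 last_cat.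
  by rewrite last_rcons.
case: (chord_tour _ _ _ _) => //= f c lfc /andP[ef fc].
by rewrite rcons_path fc lfc.
Qed.

End EdgeOf.

Lemma line_graph_star_cycle x k :
  2 < k <= #|adj x| -> has_cycle_of_length (line_graph G) k.
Proof.
case/andP=> k_gt2 k_le.
have [y xy] : exists y, y \in adj x.
  by apply/card_gt0P; apply: leq_trans k_le; apply: leq_trans k_gt2.
pose e0 : edge G := Sub [set x; y] (is_edge_adj xy).
pose c := take k [seq edge_of e0 x z | z in adj x].
have sc : size c = k by rewrite size_takel // size_map -cardE.
rewrite -sc; apply: has_cycle_line_graph; first by rewrite sc.
  rewrite take_uniq // map_inj_in_uniq ?enum_uniq // => z t.
  by rewrite !mem_enum; apply: edge_of_inj.
have: {in c, forall e, x \in val e}.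
  by move=> e /mem_take/imageP[z xz ->]; rewrite mem_edge_of ?eqxx.
case: c {sc} => //= e c xc; apply: (@path_meets_star x).
  by apply: xc; rewrite mem_head.
by move=> f; rewrite mem_rcons; apply: xc.
Qed.

Definition dominating (c : seq G) : Prop :=
  forall e, exists v, (v \in val e) && (v \in c).

Lemma line_graph_dominating_cycle x p k :
  1 < size p -> uniq (x :: p) -> cycle (@adj G) (x :: p) ->
  dominating (x :: p) -> size p < k <= #|edge G| ->
  has_cycle_of_length (line_graph G) k.
Proof.
move=> p_gt1 uxp cxp dom /andP[p_lt k_le].
have [e0 _] : exists e, e \in edge G.
  by apply/card_gt0P; apply: leq_trans k_le; apply: leq_trans p_lt.
set C := cycle_edges e0 x p; have uC : uniq C by apply: uniq_cycle_edges.
have sC : size C = (size p).+1 by rewrite size_pairmap size_rcons.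
pose D := take (k - size C) (enum [predC C]).
have sD : size D = k - size C.
  by rewrite size_takel // leq_subLR -cardE -(card_uniqP uC) cardC.
pose h e := xchoose (dom e).
have /all_and2[hP hp] e : h e \in val e /\ h e \in x :: p.
  exact/andP/(xchooseP (dom e)).
have tourP := perm_chord_tour e0 D uxp hp.
have st : size (chord_tour e0 h D x p) = k.
  by rewrite (perm_size tourP) size_cat sD subnK // sC.
rewrite -st; apply: has_cycle_line_graph; last exact: cycle_chord_tour.
  by rewrite st; apply: leq_trans p_lt.
rewrite (perm_uniq tourP) cat_uniq uC take_uniq ?enum_uniq //= andbT.
by apply/hasPn => e eC; apply/negP => /mem_take; rewrite mem_enum inE /= eC.
Qed.

Lemma size_cycle_le_card_edge x p :
  1 < size p -> uniq (x :: p) -> cycle (@adj G) (x :: p) ->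
  size (x :: p) <= #|edge G|.
Proof.
move=> p_gt1 uxp cxp.
have [e0] : inhabited (edge G).
  case: p p_gt1 cxp {uxp} => // y p _ /= /andP[xy _].
  by split; exact: (Sub [set x; y] (is_edge_adj xy)).
have /card_uniqP := uniq_cycle_edges e0 uxp p_gt1 cxp.
by rewrite size_pairmap size_rcons => /= <-; apply: max_card.
Qed.

Lemma pancyclic_line_graph_dominating x p :
  1 < size p -> uniq (x :: p) -> cycle (@adj G) (x :: p) ->
  dominating (x :: p) -> size p <= #|adj x| -> pancyclic (line_graph G).
Proof.
move=> p_gt1 uxp cxp dom p_le; split=> [|k /andP[k_gt2 k_le]].
  exact: leq_trans (size_cycle_le_card_edge p_gt1 uxp cxp).
have [kp|pk] := leqP k (size p).
- by apply: (@line_graph_star_cycle x); rewrite k_gt2 (leq_trans kp).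
- by apply: line_graph_dominating_cycle p_gt1 uxp cxp dom _; rewrite pk.
Qed.

Lemma universal_half_hamiltonian (A D : {set G}) :
  A \subset D -> 1 < #|D| <= 2 * #|A| ->
  {in A & D, forall x y, x != y -> adj x y} ->
  exists a p,
    [/\ a \in A, uniq (a :: p), a :: p =i D & cycle (@adj G) (a :: p)].
Proof.
move=> sAD /andP[D_gt1 leDA] univ.
case enumA: (enum A) => [|a t].
  by have := ltnW (leq_trans D_gt1 leDA); rewrite cardE enumA.
have memA y : (y \in A) = (y \in a :: t) by rewrite -enumA mem_enum.
have aA : a \in A by rewrite memA mem_head.
pose p := interleave (enum (D :\: A)) t.
have permD : perm_eq (a :: p) (enum D).
  apply: (@perm_trans _ (enum A ++ enum (D :\: A))).
    by rewrite enumA /= perm_cons perm_sym perm_catC perm_sym perm_interleave.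
  apply: uniq_perm; rewrite ?enum_uniq ?cat_uniq ?enum_uniq ?andbT //=.
    by apply/hasPn => y; rewrite !mem_enum inE => /andP[].
  move=> y; rewrite mem_cat !mem_enum !inE; case: (boolP (y \in A)) => //= yA.
  by rewrite (subsetP sAD).
have memD : a :: p =i D by move=> y; rewrite (perm_mem permD) mem_enum.
have uap : uniq (a :: p) by rewrite (perm_uniq permD) enum_uniq.
have altp : cycle [rel x y | (x \in A) || (y \in A)] (a :: p).
  rewrite /= rcons_path /= aA orbT andbT.
  apply: (@path_interleave _ [in A]) => //.
    by apply/allP => y yt; rewrite memA inE yt orbT.
  rewrite -cardE -[(size t).+1]/(size (a :: t)) -enumA -cardE cardsD.
  by rewrite (setIidPr sAD) leq_subLR addnn -mul2n.
exists a, p; split=> //.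
have ap_gt1 : 1 < size (a :: p) by rewrite (perm_size permD) -cardE.
apply: (sub_in_cycle (P := [in D])) (cycle_uniq_neq ap_gt1 uap altp).
- move=> y z yD zD /= /andP[yz /orP[yA|zA]]; first exact: univ yA zD yz.
  by rewrite adj_sym; apply: univ zA yD _; rewrite eq_sym.
- by apply/allP => y; rewrite memD.
Qed.

Lemma pancyclic_line_graph_universal_half (A D : {set G}) :
  A \subset D -> 2 < #|D| <= 2 * #|A| ->
  {in A & D, forall x y, x != y -> adj x y} ->
  (forall x y, adj x y -> x \in D) ->
  pancyclic (line_graph G).
Proof.
move=> sAD /andP[D_gt2 leDA] univ adjD.
have [|a [p [aA uap memD cap]]] := universal_half_hamiltonian sAD _ univ.
  by rewrite ltnW.
have sp : (size p).+1 = #|D| by rewrite -(eq_card memD) (card_uniqP uap).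
have /andP[aNp up] := uap.
apply: pancyclic_line_graph_dominating uap cap _ _; first by rewrite -ltnS sp.
- move=> e; have /existsP[y /existsP[z /andP[yz /eqP ->]]] := valP e.
  by exists y; rewrite memD (adjD _ _ yz) !inE eqxx.
- rewrite -(card_uniqP up); apply/subset_leq_card/subsetP => y yp.
  apply: univ aA _ _; first by rewrite -memD inE yp orbT.
  by apply: contraTneq yp => <-.
Qed.

End LineGraph.

Local Open Scope ring_scope.

Lemma mul1D_nilpotent_eq0 (R : pzRingType) (t y : R) k :
  t ^+ k = 0 -> (1 + t) * y = 0 -> y = 0.
Proof.
move=> tk0 /eqP; rewrite mulrDl mul1r addr_eq0 -mulNr => /eqP yE.
have {}yE j : y = (- t) ^+ j * y.
  by elim: j => [|j IHj]; rewrite ?mul1r // exprSr -mulrA -yE.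
by rewrite (yE k) exprNn tk0 mulr0 mul0r.
Qed.

Section ZeroDivisors.
Variable R : finComNzRingType.
Implicit Types x y : R.

Lemma zero_divisorMr x y : zero_divisor x -> zero_divisor (x * y).
Proof.
move=> /existsP[z /andP[z0 /eqP xz]]; apply/existsP; exists z.
by rewrite z0 mulrAC xz mul0r /=.
Qed.

Lemma nilpotent_zero_divisor x k : x ^+ k = 0 -> zero_divisor x.
Proof.
move=> /eqP xk; have ex : exists k, x ^+ k == 0 by exists k.
case: (ex_minnP ex) => -[|j]; first by rewrite oner_eq0.
move=> xj0 jmin; apply/existsP; exists (x ^+ j); rewrite -exprS xj0 andbT.
by apply/negP => /jmin; rewrite ltnn.
Qed.

Definition principal_ideal x : {set R} := [set x * y | y in R].

Lemma mem_principal_ideal x y : x * y \in principal_ideal x.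
Proof. exact: imset_f. Qed.

Lemma principal_ideal1 : principal_ideal 1 = setT.
Proof. by apply/setP => x; rewrite inE -[x]mul1r mem_principal_ideal. Qed.

Lemma principal_ideal0 : principal_ideal 0 = [set 0].
Proof.
apply/setP => x; rewrite inE; apply/imsetP/eqP => [[y _ ->]|->].
- exact: mul0r.
- by exists 0; rewrite ?mul0r.
Qed.

Definition residues01 x : Prop :=
  forall y, y \in principal_ideal x \/ y - 1 \in principal_ideal x.

End ZeroDivisors.

(* [R] is local with maximal ideal [(p)] and residue field of order 2. *)
Section NilpotentGenerator.
Variables (R : finComNzRingType) (p : R) (k : nat).
Hypothesis p_nilp : p ^+ k = 0.
Hypothesis p_residues : residues01 p.
Implicit Types x y z : R.

Lemma mul1D_multiple_eq0 z y : (1 + p * z) * y = 0 -> y = 0.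
Proof.
by apply: (@mul1D_nilpotent_eq0 _ _ _ k); rewrite exprMn p_nilp mul0r.
Qed.

Lemma zero_divisorE x : zero_divisor x = (x \in principal_ideal p).
Proof.
apply/idP/idP => [/existsP[y /andP[y0 /eqP xy0]]|/imsetP[z _ ->]]; last first.
  exact/zero_divisorMr/(nilpotent_zero_divisor p_nilp).
have [//|/imsetP[z _ /eqP]] := p_residues x.
rewrite subr_eq addrC => /eqP xE; case/eqP: y0.
by apply: (@mul1D_multiple_eq0 z); rewrite -xE.
Qed.

Lemma card_principal_ideal_le x :
  (#|principal_ideal x| <= 2 * #|principal_ideal (x * p)%R|)%N.
Proof.
set I := principal_ideal (x * p); rewrite mul2n -addnn.
apply: (@leq_trans #|I :|: [set x + y | y in I]|); last first.
  by rewrite (leq_trans (leq_card_setU _ _)) // leq_add2l leq_imset_card.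
apply/subset_leq_card/subsetP => _ /imsetP[y _ ->]; rewrite inE.
have [/imsetP[z _ ->]|/imsetP[z _ /eqP]] := p_residues y.
  by rewrite mulrA mem_principal_ideal.
rewrite subr_eq addrC => /eqP ->; rewrite mulrDr mulr1 mulrA.
by rewrite imset_f ?mem_principal_ideal // orbT.
Qed.

Definition uniformizers : {set R} :=
  [set p + y | y in principal_ideal (p * p)].

Lemma card_uniformizers : #|uniformizers| = #|principal_ideal (p * p)|.
Proof. by rewrite card_imset //; apply: addrI. Qed.

Lemma uniformizer_factor x :
  x \in uniformizers -> exists z, x = (1 + p * z) * p.
Proof.
move=> /imsetP[_ /imsetP[z _ ->] ->]; exists z.
by rewrite mulrDl mul1r mulrAC.
Qed.

Lemma uniformizer_mul_eq0 x y : x \in uniformizers -> x * y = 0 -> p * y = 0.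
Proof.
by move=> /uniformizer_factor[z ->]; rewrite -mulrA => /mul1D_multiple_eq0.
Qed.

Lemma card_ring_le_uniformizers : (#|R| <= 4 * #|uniformizers|)%N.
Proof.
have := card_principal_ideal_le 1.
rewrite principal_ideal1 cardsT mul1r => /leq_trans; apply.
by rewrite -[4%N]/(2 * 2)%N -mulnA leq_pmul2l // card_uniformizers
  card_principal_ideal_le.
Qed.

Lemma sqr_generator_neq0 : (4 < #|R|)%N -> p * p != 0.
Proof.
move=> R_gt4; apply/eqP => pp0.
have := leq_trans R_gt4 card_ring_le_uniformizers.
by rewrite card_uniformizers pp0 principal_ideal0 cards1.
Qed.

Local Notation V := (zdg_vertex R).

Lemma card_zdg_vertex_le : (#|{: V}| <= #|principal_ideal p|)%N.
Proof.
rewrite card_sig; apply/subset_leq_card/subsetP => x /andP[_].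
by rewrite zero_divisorE.
Qed.

Definition uniformizer_vertices : {set V} := [set x | val x \in uniformizers].

Lemma card_uniformizer_vertices :
  p * p != 0 -> #|uniformizer_vertices| = #|uniformizers|.
Proof.
move=> pp0; rewrite -(card_imset _ val_inj); congr #|pred_of_set _|.
apply/setP => x; apply/imsetP/idP => [[y + ->]|xU]; first by rewrite inE.
have xV : (x != 0) && zero_divisor x.
  have [z xE] := uniformizer_factor xU.
  rewrite zero_divisorE {2}xE mulrC mem_principal_ideal andbT.
  apply: contraNneq pp0 => x0; rewrite (uniformizer_mul_eq0 xU) //.
  by rewrite x0 mul0r.
by exists (Sub x xV); rewrite ?inE ?SubK.
Qed.

Lemma pancyclic_line_graph_compl_zdg :
  (8 < #|R|)%N ->
  pancyclic (line_graph (complement_graph (zero_divisor_graph R))).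
Proof.
set G := complement_graph _ => R_gt8.
have pp0 := sqr_generator_neq0 (ltn_trans (isT : 4 < 8)%N R_gt8).
pose A := uniformizer_vertices; pose D : {set V} := [set x | p * val x != 0].
have sAD : A \subset D.
  apply/subsetP => x; rewrite !inE => xU; apply: contra pp0 => /eqP px0.
  by rewrite (uniformizer_mul_eq0 xU) // mulrC.
have leDA : (#|D| <= 2 * #|A|)%N.
  rewrite card_uniformizer_vertices // card_uniformizers.
  apply: leq_trans (max_card _) (leq_trans card_zdg_vertex_le _).
  exact: card_principal_ideal_le.
have D_gt2 : (2 < #|D|)%N.
  apply: leq_trans (subset_leq_card sAD); rewrite card_uniformizer_vertices //.
  by rewrite -(@ltn_pmul2l 4) // (leq_trans R_gt8) // card_ring_le_uniformizers.
apply: (@pancyclic_line_graph_universal_half G A D) => //; first exact/andP.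
- move=> x y; rewrite !inE => xU py xy; rewrite /= /compl_adj /= /zdg_adj xy /=.
  by apply: contra py => /eqP/(uniformizer_mul_eq0 xU) ->.
- move=> x y; rewrite /= /compl_adj /= /zdg_adj inE => /andP[-> /=].
  apply: contra => /eqP px0; have /andP[_] := valP y.
  rewrite zero_divisorE => /imsetP[z _ ->].
  by rewrite mulrA [_ * p]mulrC px0 mul0r.
Qed.

End NilpotentGenerator.

Section GaussianOnePlusI.
Variable R : comNzRingType.
Local Notation Zi := (gaussian R).
Local Notation p := (Gaussian 1 1 : Zi).

Lemma natr_gaussian j : j%:R = Gaussian j%:R 0 :> Zi.
Proof.
by elim: j => // j IHj; rewrite !mulrSr IHj; congr Gaussian; apply: addr0.
Qed.

Lemma one_plus_i_sqr : p ^+ 2 = 2%:R * Gaussian 0 1.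
Proof. by rewrite natr_gaussian expr2; congr Gaussian => /=; ring. Qed.

Lemma one_plus_i_nilpotent j : (2 ^ j)%:R = 0 :> R -> p ^+ (2 * j) = 0.
Proof.
move=> j0; rewrite exprM one_plus_i_sqr exprMn -natrX natr_gaussian j0.
exact: mul0r.
Qed.

Lemma gaussian_one_plus_i_factor (b c : R) :
  Gaussian (b + 2 * c) b = p * Gaussian (b + c) (- c).
Proof. by congr Gaussian => /=; ring. Qed.

End GaussianOnePlusI.

Lemma residues01_one_plus_i (R : finComNzRingType) :
  residues01 (2 : R) -> residues01 (Gaussian 1 1 : gaussian R).
Proof.
move=> res2 [a b].
have [/imsetP[c _ abE]|/imsetP[c _ abE]] := res2 (a - b); [left|right].
- have -> : a = b + 2 * c by rewrite -abE addrC subrK.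
  by rewrite gaussian_one_plus_i_factor mem_principal_ideal.
- have -> : Gaussian a b - 1 = Gaussian (b + 2 * c) b.
    by rewrite -abE; congr Gaussian => /=; ring.
  by rewrite gaussian_one_plus_i_factor mem_principal_ideal.
Qed.

Lemma residues01_Zp n : residues01 (2 : 'Z_n).
Proof.
move=> a; have := natr_Zp a; rewrite -(odd_double_half a) -mul2n natrD natrM.
case: (odd a) => /= <-; [right|left].
  by rewrite addrAC subrr add0r mem_principal_ideal.
by rewrite add0r mem_principal_ideal.
Qed.

Lemma card_gaussian (T : finType) : #|{: gaussian T}| = (#|T| ^ 2)%N.
Proof.
rewrite -mulnn -card_prod; apply: (bij_eq_card (f := @pair_of_gaussian T)).
exists (@gaussian_of_pair T) => //; [exact: pair_of_gaussianK | by case].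
Qed.

Local Close Scope ring_scope.

Theorem theorem5p1 (m n : nat) (hm : 2 <= m) (hn : n = 2 ^ m) :
  pancyclic (line_graph (complement_graph (zero_divisor_graph (gaussian 'Z_n)))).
Proof.
have n_ge4 : 2 ^ 2 <= n by rewrite hn leq_exp2l.
have n_gt1 : 1 < n by apply: leq_trans n_ge4.
have nilp : ((Gaussian 1 1 : gaussian 'Z_n) ^+ (2 * m) = 0)%R.
  by apply: one_plus_i_nilpotent; rewrite -hn pchar_Zp.
have residues := residues01_one_plus_i (@residues01_Zp n).
apply: (pancyclic_line_graph_compl_zdg nilp residues).
rewrite card_gaussian card_ord Zp_cast //.
by apply: leq_trans (_ : 4 ^ 2 <= _); rewrite ?leq_exp2r.
Qed.
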